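(* Let $\mathcal{D}$ be a distribution supported on $(0,1]$ with mean $\mu$. Fix $n,m$, a preference profile $\sigma$, and $\epsilon,\delta>0$, and let $T=\frac{2\log(2m/\delta)}{\mu^2\epsilon^2}$. Draw $T$ independent batches of $nm$ i.i.d. samples from $\mathcal{D}$. In batch $t$, give each voter $i$ her own $m$ samples, and let $Y^{i,t}_r$ denote the $r$-th largest of them. For each alternative $j$, letting $r^j_i$ be the position of $j$ in voter $i$'s ranking, define $$\hat\mu_j=\frac1T\sum_{t=1}^T\frac{\sum_{i=1}^n Y^{i,t}_{r^j_i}}{\max_{k\in A}\sum_{i=1}^n Y^{i,t}_{r^k_i}},$$ and let $j_{\mathrm{samp}}\in\arg\max_j\hat\mu_j$. Then with probability at least $1-\delta$ (over the samples), $$\mathbb{E}[\mathrm{dist}(j_{\mathrm{samp}},\sigma)]\ge(1-\epsilon)\max_{j\in A}\mathbb{E}[\mathrm{dist}(j,\sigma)].$$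
   Context: There are $n$ voters and $m$ alternatives $A=\{1,\dots,m\}$. A preference profile $\sigma$ consists of a ranking of $A$ for each voter; position $1$ is the top. Given $\mathcal{D}$ and $\sigma$, a random utility profile $u$ consistent with $\sigma$ is generated as follows: independently for each voter $i$, draw $m$ i.i.d. samples from $\mathcal{D}$ and assign them, from highest to lowest, to the alternatives in the order of voter $i$'s ranking. The social welfare of $j$ is $\mathrm{sw}(j,u)=\sum_i u_{ij}$, and the distortion of $j$ at $\sigma$ is the random variable $\mathrm{dist}(j,\sigma)=\mathrm{sw}(j,u)/\max_{k\in A}\mathrm{sw}(k,u)$; $\mathbb{E}[\mathrm{dist}(j,\sigma)]$ is the expectation over a fresh such $u$ (for fixed $j_{\mathrm{samp}}$). *)

(* Defs.v *)
From HB Require Import structures.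
From mathcomp Require Import all_boot all_order all_algebra all_fingroup.
From mathcomp Require Import all_classical all_reals all_analysis.
Set Implicit Arguments. Unset Strict Implicit. Unset Printing Implicit Defensive.
Import Order.TTheory GRing.Theory Num.Theory.
Local Open Scope classical_set_scope.
Local Open Scope ring_scope.

(* Mutual independence + identical distribution (law D) of a finite family of
   real random variables on a probability space P.  For a finite family,
   mutual independence is the product rule for every choice of Borel sets
   (subfamilies are obtained by choosing B i = setT). *)
Definition iid_family {d} {Omega : measurableType d} {R : realType}
  (I : finType) (P : probability Omega R) (D : probability R R)
  (X : I -> Omega -> R) : Prop :=
  [/\ (forall i, measurable_fun setT (X i)),
      (forall i (B : set R), measurable B -> P (X i @^-1` B) = D B) &
      (forall B : I -> set R, (forall i, measurable (B i)) ->
         P (\bigcap_(i in [set: I]) (X i @^-1` B i)) =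
         (\prod_(i : I) P (X i @^-1` B i))%E)].

(* Alternatives are 'I_m, voters 'I_n.  A preference profile assigns to each
   voter i a ranking sigma i : {perm 'I_m}, mapping a position r (0 = top)
   to the alternative ranked at position r. *)
Definition profile (n m : nat) := 'I_n -> {perm 'I_m}.

Definition pos {n m} (sigma : profile n m) (i : 'I_n) (j : 'I_m) : 'I_m :=
  ((sigma i)^-1)%g j.

Definition kth_largest {R : realType} {m} (x : 'I_m -> R) (r : 'I_m) : R :=
  nth 0 (sort (fun a b => b <= a) [seq x k | k <- enum 'I_m]) r.

Definition util {R : realType} {n m} (sigma : profile n m)
  (Y : 'I_n -> 'I_m -> R) (i : 'I_n) (j : 'I_m) : R :=
  kth_largest (Y i) (pos sigma i j).

Definition sw {R : realType} {n m} (sigma : profile n m)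
  (Y : 'I_n -> 'I_m -> R) (j : 'I_m) : R :=
  \sum_(i < n) util sigma Y i j.

Definition distortion {R : realType} {n m} (sigma : profile n m)
  (Y : 'I_n -> 'I_m -> R) (j : 'I_m) : R :=
  sw sigma Y j / \big[Num.max/0]_(k < m) sw sigma Y k.

(* E[dist(j, sigma)], computed with fresh samples Z (an i.i.d. family of law D
   on some probability space Q) *)
Definition exp_dist {dQ} {OmegaQ : measurableType dQ} {R : realType}
  (Q : probability OmegaQ R) {n m} (Z : 'I_n -> 'I_m -> OmegaQ -> R)
  (sigma : profile n m) (j : 'I_m) : \bar R :=
  'E_Q[fun w => distortion sigma (fun i r => Z i r w) j].

Definition mu_hat {d} {Omega : measurableType d} {R : realType} {T n m : nat}
  (sigma : profile n m) (X : 'I_T -> 'I_n -> 'I_m -> Omega -> R)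
  (w : Omega) (j : 'I_m) : R :=
  (T%:R)^-1 * \sum_(t < T) distortion sigma (fun i r => X t i r w) j.

Definition num_batches {R : realType} (m : nat) (mu eps delta : R) : nat :=
  `|Num.ceil (2 * ln (2 * m%:R / delta) / (mu ^+ 2 * eps ^+ 2))|%N.

(* Main.v *)
(* The distortion of every alternative lies in [0, 1] once all samples lie in
   (0, 1], so mu_hat j is an average of T independent [0, 1]-valued variables
   with mean E[dist(j, sigma)].  By Hoeffding's inequality it deviates from this
   mean by eps * mu / 2 with probability at most
   2 exp(- T eps^2 mu^2 / 2) <= delta / m, and a union bound over the m
   alternatives makes all the estimates accurate simultaneously with probability
   at least 1 - delta.  The maximiser of mu_hat then loses at most eps * mu.  This
   is at most eps * max_j E[dist(j, sigma)]: as the maximal welfare is at most n,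
   sum_j E[dist(j, sigma)] >= sum_j E[sw(j)] / n = m mu. *)
Require Import Defs.
From HB Require Import structures.
From mathcomp Require Import all_boot all_order all_algebra all_fingroup.
From mathcomp Require Import all_classical all_reals all_analysis.
From mathcomp Require Import measurable_realfun.
From mathcomp Require Import ring lra.
Import Order.TTheory GRing.Theory Num.Theory.
Import numFieldNormedType.Exports.
Local Open Scope classical_set_scope.
Local Open Scope ring_scope.
Set Implicit Arguments. Unset Strict Implicit. Unset Printing Implicit Defensive.

(** * Independence *)

Lemma indep_sigma_algebra d (T : measurableType d) (R : realType)
    (P : probability T R) (G1 G2 : set (set T)) :
  G1 `<=` measurable -> G2 `<=` measurable ->
  setI_closed G1 -> setI_closed G2 -> G1 setT -> G2 setT ->
  (forall A B, G1 A -> G2 B -> P (A `&` B) = (P A * P B)%E) ->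
  forall A B, <<s G1 >> A -> <<s G2 >> B -> P (A `&` B) = (P A * P B)%E.
Proof.
move=> mG1 mG2 G1I G2I G1T G2T G12.
have half (G : set (set T)) (B : set T) : G `<=` measurable -> setI_closed G ->
    G setT -> measurable B -> (forall A, G A -> P (A `&` B) = (P A * P B)%E) ->
    forall A, <<s G >> A -> P (A `&` B) = (P A * P B)%E.
  move=> mG GI GT mB GB A sA.
  have PB0 : 0 <= fine (P B) by rewrite fine_ge0.
  have -> : P (A `&` B) = mrestr P mB A by [].
  have scaleE C : mscale (NngNum PB0) P C = (P C * P B)%E.
    by rewrite /mscale/= fineK ?fin_num_measure// muleC.
  rewrite -(scaleE A).
  apply: (g_sigma_algebra_measure_unique G _ (fun=> setT) _ _
    (mrestr P mB) (mscale (NngNum PB0) P)) => //.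
  - by rewrite bigcup_const.
  - by move=> C GC; exact: etrans (GB _ GC) (esym (scaleE C)).
  - by move=> _; rewrite /= /mrestr setTI;
      exact: le_lt_trans (probability_le1 _ mB) (ltry _).
have sm (G : set (set T)) : G `<=` measurable -> <<s G >> `<=` measurable.
  by move=> mG; apply: smallest_sub => //; exact: sigma_algebra_measurable.
move=> A B sA sB; apply: (half G1) => //; first exact: sm sB.
move=> C GC; rewrite setIC muleC; apply: (half G2) => //; first exact: mG1.
by move=> D GD; rewrite setIC muleC G12.
Qed.

Lemma integral_prod_mul d1 d2 (T1 : measurableType d1) (T2 : measurableType d2)
    (R : realType) (m1 : {sigma_finite_measure set T1 -> \bar R})
    (m2 : {sigma_finite_measure set T2 -> \bar R})
    (f : T1 -> \bar R) (g : T2 -> \bar R) :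
  measurable_fun setT f -> measurable_fun setT g ->
  (forall x, 0 <= f x)%E -> (forall y, 0 <= g y)%E ->
  (\int[m1 \x m2]_z (f z.1 * g z.2) = \int[m1]_x f x * \int[m2]_y g y)%E.
Proof.
move=> mf mg f0 g0; rewrite fubini_tonelli1; last 2 first.
- by apply: emeasurable_funM; exact: measurableT_comp.
- by move=> z; rewrite mule_ge0.
rewrite -ge0_integralZr//; last by apply: integral_ge0.
by apply: eq_integral => x _; rewrite /fubini_F /= ge0_integralZl.
Qed.

(** Independence says that the law of the pair [(U, V)] agrees on rectangles with the product of the
    marginal laws, hence equals it; Tonelli then splits the integral. *)
Lemma expectation_mul_indep d (T : measurableType d) (R : realType)
    (P : probability T R) (U V : T -> R) :
  measurable_fun setT U -> measurable_fun setT V ->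
  (forall x, 0 <= U x) -> (forall x, 0 <= V x) ->
  (forall A B, measurable A -> measurable B ->
     P (U @^-1` A `&` V @^-1` B) = (P (U @^-1` A) * P (V @^-1` B))%E) ->
  ('E_P[(fun x => U x * V x)%R] = 'E_P[U] * 'E_P[V])%E.
Proof.
move=> mU mV U0 V0 UV.
pose U' : {mfun T >-> R} := HB.pack U (isMeasurableFun.Build _ _ _ _ U mU).
pose V' : {mfun T >-> R} := HB.pack V (isMeasurableFun.Build _ _ _ _ V mV).
pose W := fun x => (U x, V x).
have mW : measurable_fun setT W by exact: measurable_fun_pair.
pose W' : {mfun T >-> (R * R)%type} := HB.pack W (isMeasurableFun.Build _ _ _ _ W mW).
(* Under the laws on [R] the integrand must be nonnegative everywhere, hence [|x|] instead of [x];
   on the values of [U] and [V] they agree. *)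
have mnorm : measurable_fun setT (fun x : R => `|x|%:E).
  by apply/measurable_EFinP; exact: normr_measurable.
have EV : (\int[distribution P V']_y `|y|%:E = 'E_P[V])%E.
  rewrite ge0_integral_distribution// unlock.
  by apply: eq_integral => x _ /=; rewrite ger0_norm.
have EU : (\int[distribution P U']_y `|y|%:E = 'E_P[U])%E.
  rewrite ge0_integral_distribution// unlock.
  by apply: eq_integral => x _ /=; rewrite ger0_norm.
transitivity (\int[distribution P W']_z (`|z.1|%:E * `|z.2|%:E))%E.
  rewrite ge0_integral_distribution; last 2 first.
  - apply: emeasurable_funM; apply: (measurableT_comp mnorm).
      exact: measurable_fst.
    exact: measurable_snd.
  - by move=> z; rewrite mule_ge0.
  rewrite unlock; apply: eq_integral => x _ /=.
  by rewrite !ger0_norm// EFinM.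
rewrite (eq_measure_integral (distribution P U' \x distribution P V')%E); last first.
  move=> A mA _; apply/esym; exact: product_measure_unique.
rewrite -EU -EV.
exact: (@integral_prod_mul _ _ _ _ R (distribution P U') (distribution P V')).
Qed.

(* [<<s cylinder X S>>] is the sigma-algebra generated by the [X i], [i \in S]. *)
Definition cylinder T (R : realType) (I : finType) (X : I -> T -> R)
    (S : {pred I}) : set (set T) :=
  [set A | exists B : I -> set R, [/\ forall i, measurable (B i),
     forall i, i \notin S -> B i = setT & A = \bigcap_(i in [set: I]) X i @^-1` B i]].

Section cylinder.
Variables (T : pointedType) (R : realType) (I : finType) (X : I -> T -> R).

Lemma cylinderT (S : {pred I}) : cylinder X S setT.
Proof.
by exists (fun=> setT); split => //; apply/esym; rewrite -subTset => x _ i _.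
Qed.

Lemma cylinderI (S : {pred I}) : setI_closed (cylinder X S).
Proof.
move=> _ _ [B1 [mB1 B1S ->]] [B2 [mB2 B2S ->]].
exists (fun i => B1 i `&` B2 i); split.
- by move=> i; exact: measurableI.
- by move=> i iS; rewrite B1S// B2S// setIT.
- by rewrite -bigcapI.
Qed.

Lemma sub_cylinder (S1 S2 : {pred I}) : {subset S1 <= S2} ->
  cylinder X S1 `<=` cylinder X S2.
Proof.
move=> S12 _ [B [mB BS ->]]; exists B; split => // i iS2; apply: BS.
by apply: contra iS2 => /S12.
Qed.

Lemma measurable_coord (S : {pred I}) (i : I) : i \in S ->
  measurable_fun [set: g_sigma_algebraType (cylinder X S)] (X i).
Proof.
move=> iS _ B mB; rewrite setTI; apply: sub_sigma_algebra.
exists (fun k => if k == i then B else setT); split.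
- by move=> k; case: ifP.
- by move=> k; case: ifPn => // /eqP ->; rewrite iS.
- apply/seteqP; split => [x Bx k _|x h]; last by have := h i Logic.I; rewrite /= eqxx.
  by rewrite /=; case: ifPn => // /eqP ->.
Qed.

End cylinder.

Section cylinder_measurable.
Variables (d : measure_display) (T : measurableType d) (R : realType) (I : finType).
Variable X : I -> T -> R.
Hypothesis mX : forall i, measurable_fun setT (X i).

Lemma cylinder_measurable (S : {pred I}) : cylinder X S `<=` measurable.
Proof.
move=> _ [B [mB _ ->]]; apply: fin_bigcap_measurable; first exact: finite_finset.
by move=> i _; rewrite -[_ @^-1` _]setTI; exact: mX.
Qed.

Variable P : probability T R.
Hypothesis indX : forall B : I -> set R, (forall i, measurable (B i)) ->
  P (\bigcap_(i in [set: I]) (X i @^-1` B i)) = (\prod_(i : I) P (X i @^-1` B i))%E.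

(** For each [i] at least one of [B1 i] and [B2 i] is [setT], so the product rule for the sets
    [B1 i]&[B2 i] splits factor by factor. *)
Lemma indep_cylinder (S1 S2 : {pred I}) : {in S1, forall i, i \notin S2} ->
  forall A B, cylinder X S1 A -> cylinder X S2 B -> P (A `&` B) = (P A * P B)%E.
Proof.
move=> S12 _ _ [B1 [mB1 B1S ->]] [B2 [mB2 B2S ->]].
rewrite -bigcapI (indX mB1) (indX mB2) -big_split/=.
rewrite (indX (B := fun i => B1 i `&` B2 i)); last first.
  by move=> i; exact: measurableI.
apply: eq_bigr => i _; have [iS1|iS1] := boolP (i \in S1).
  have iS2 : i \notin S2 by exact: S12.
  by rewrite (B2S i)//= setIT preimage_setT probability_setT mule1.
by rewrite (B1S i)//= setTI preimage_setT probability_setT mul1e.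
Qed.

End cylinder_measurable.

Lemma measurable_fun_g_sigma_sub (T : pointedType) d' (T' : measurableType d')
    (G1 G2 : set (set T)) (f : T -> T') : G1 `<=` G2 ->
  measurable_fun [set: g_sigma_algebraType G1] f ->
  measurable_fun [set: g_sigma_algebraType G2] f.
Proof.
by move=> G12 mf _ B mB; apply: (sub_sigma_algebra2 G12); exact: mf.
Qed.

Lemma measurable_fun_g_sigma d (T : measurableType d) d' (T' : measurableType d')
    (G : set (set T)) (f : T -> T') : G `<=` measurable ->
  measurable_fun [set: g_sigma_algebraType G] f -> measurable_fun [set: T] f.
Proof.
move=> Gm mf _ B mB; have := mf measurableT B mB.
by apply: smallest_sub => //; exact: sigma_algebra_measurable.
Qed.

(* Measurability for the cylinders over block [j] says that [U j] depends on the
   [X i] with [l i = j] only. *)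
Lemma expectation_prod_blocks d (T : measurableType d) (R : realType)
    (P : probability T R) (I J : finType) (X : I -> T -> R) (l : I -> J)
    (U : J -> T -> R) (s : seq J) :
  (forall i, measurable_fun setT (X i)) ->
  (forall B : I -> set R, (forall i, measurable (B i)) ->
     P (\bigcap_(i in [set: I]) (X i @^-1` B i)) = (\prod_(i : I) P (X i @^-1` B i))%E) ->
  (forall j, measurable_fun
     [set: g_sigma_algebraType (cylinder X [pred i | l i == j])] (U j)) ->
  (forall j x, 0 <= U j x) -> uniq s ->
  ('E_P[(fun x => \prod_(j <- s) U j x)%R] = \prod_(j <- s) 'E_P[U j])%E.
Proof.
move=> mX indX mU U0.
have mprod (r : seq J) : measurable_fun
    [set: g_sigma_algebraType (cylinder X [pred i | l i \in r])]
    (fun x => \prod_(j <- r) U j x).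
  apply: measurable_prod => j jr.
  apply: measurable_fun_g_sigma_sub (mU j); apply: sub_cylinder => i.
  by rewrite !inE => /eqP ->.
have cm S := cylinder_measurable mX (S := S).
elim: s => [_|j s IH /= /andP[js us]].
  by under [X in expectation _ X]eq_fun do rewrite big_nil; rewrite expectation_cst big_nil.
under [X in expectation _ X]eq_fun do rewrite big_cons.
rewrite big_cons -IH//; apply: expectation_mul_indep => //.
- exact: measurable_fun_g_sigma (mU j).
- exact: measurable_fun_g_sigma (mprod s).
- by move=> x; apply: prodr_ge0.
move=> A B mA mB.
(* The head depends on block [j] only and the tail product on the blocks in [s]; these are disjoint
   because [j] is not in [s]. *)
apply: (indep_sigma_algebra (G1 := cylinder X [pred i | l i == j])
  (G2 := cylinder X [pred i | l i \in s])) => //; try exact: cylinderI; try exact: cylinderT.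
- by apply: indep_cylinder => // i; rewrite !inE => /eqP ->.
- by rewrite -[X in _ X]setTI; apply: mU.
- by rewrite -[X in _ X]setTI; apply: mprod.
Qed.

(** * Hoeffding's inequality *)

Lemma le_at0_of_derive_le0 (R : realType) (f g : R -> R) (s : R) :
  (forall x, is_derive x (1 : R) f (g x)) -> (forall x, 0 <= x -> g x <= 0) ->
  0 <= s -> f s <= f 0.
Proof.
move=> df g0 s0; apply: (@ler0_derive1_nincry R f 0) => //.
- by move=> x; rewrite in_itv/= andbT => /ltW /g0; rewrite derive1E derive_val.
- apply: continuous_subspaceT => x.
  by apply/differentiable_continuous/derivable1_diffP.
Qed.

(** The left side is the moment generating function of a Bernoulli variable of mean [p]. Its
    logarithm minus the exponent on the right is [phi], whose derivative is [psi]. Both vanish at 0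
    and [psi] is nonincreasing on the nonnegative reals, so [psi] and then [phi] are nonpositive
    there. *)
Lemma bernoulli_mgf_le (R : realType) (p s : R) : 0 <= p <= 1 -> 0 <= s ->
  1 - p + p * expR s <= expR (p * s + s ^+ 2 / 8).
Proof.
move=> /andP[p0 p1] s0.
pose q x := 1 - p + p * expR x.
have q_gt0 x : 0 < q x.
  rewrite /q; have [->|p_neq0] := eqVneq p 0; first by rewrite subr0 mul0r addr0.
  by rewrite ltr_wpDl ?subr_ge0// mulr_gt0 ?expR_gt0// lt0r p_neq0.
have dq x : is_derive x (1 : R) q (p * expR x).
  have h : is_derive x (1 : R) (cst (1 - p) + p \*: expR) (0 + p *: expR x).
    exact: is_deriveD.
  by move: h; rewrite add0r.
pose psi x := p * expR x / q x - p - x / 4.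
have dpsi x : is_derive x (1 : R) psi (p * expR x * (1 - p) / q x ^+ 2 - 4^-1).
  have qx0 := lt0r_neq0 (q_gt0 x).
  have dqV := is_deriveV qx0 (dq x).
  have -> : psi = (p \*: expR) * (fun y => (q y)^-1) + cst (- p) - (4^-1 \*: id).
    by apply/funext => y; rewrite /psi mulrC [y / 4]mulrC [_^-1 * _]mulrC.
  apply: is_derive_eq; rewrite /= /GRing.scale/=.
  by move: qx0; rewrite /q => qx0; field.
have psi_le0 x : 0 <= x -> psi x <= 0.
  have psi0 : psi 0 = 0 by rewrite /psi /q expR0 !mulr1 subrK; field.
  move=> x0; rewrite -psi0; apply: le_at0_of_derive_le0 dpsi _ x0 => y y0.
  rewrite subr_le0 ler_pdivrMr ?exprn_gt0// /q.
  (* With [a = 1 - p] and [b = p * expR y] the goal is [a * b <= (a + b) ^+ 2 / 4], that is,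
     [(a - b) ^+ 2 >= 0]. *)
  have := sqr_ge0 (1 - p - p * expR y); nra.
pose phi x := ln (q x) - p * x - x ^+ 2 / 8.
have dphi x : is_derive x (1 : R) phi (psi x).
  have dln := is_derive1_comp (is_derive1_ln (q_gt0 x)) (dq x).
  have -> : phi = (@ln R \o q) - (p \*: id) - (8^-1 \*: (id ^+ 2)).
    by apply/funext => y; rewrite /phi mulrC [_ ^+ 2 / _]mulrC [y * p]mulrC.
  apply: is_derive_eq; rewrite /= /GRing.scale/= /psi.
  by have := lt0r_neq0 (q_gt0 x); rewrite /q => qx0; field.
have := le_at0_of_derive_le0 dphi psi_le0 s0.
rewrite [leRHS](_ : _ = 0); last by rewrite /phi /q expR0 mulr1 subrK ln1; ring.
rewrite /phi -addrA -opprD subr_le0 => h.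
by rewrite -[leLHS]lnK ?posrE ?q_gt0// ler_expR.
Qed.

Lemma expR_le_chord (R : realType) (s u : R) : 0 <= u <= 1 ->
  expR (s * u) <= 1 - u + u * expR s.
Proof.
move=> /andP[u0 u1].
have := convex_expR (Itv01 u0 u1) s 0.
rewrite !convRE /= /unstable.onem expR0 mulr0 addr0 mulr1 mulrC.
by move=> /le_trans; apply; rewrite addrC.
Qed.

(** Hoeffding's lemma: replacing the exponential by its chord over the unit interval reduces [U] to
    a Bernoulli variable of the same mean. *)
Lemma expectation_expR_le d (T : measurableType d) (R : realType)
    (P : probability T R) (U : T -> R) (p s : R) :
  measurable_fun setT U -> (forall x, 0 <= U x <= 1) -> 'E_P[U]%E = p%:E ->
  0 <= s -> ('E_P[(fun x => expR (s * U x))%R] <= (expR (p * s + s ^+ 2 / 8))%:E)%E.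
Proof.
move=> mU U01 EU s0.
have U0 x : 0 <= U x by case/andP: (U01 x).
have p01 : 0 <= p <= 1.
  rewrite -!lee_fin -EU expectation_ge0//= -(expectation_cst P 1).
  by apply: expectation_le => //; apply: aeW => x; case/andP: (U01 x).
have es : 0 <= expR s - 1 by rewrite subr_ge0 -expR0 ler_expR.
(* The chord is regrouped into nonnegative terms, so that its expectation follows from linearity for
   nonnegative integrands. *)
apply: (@le_trans _ _ 'E_P[(fun x => 1 + (expR s - 1) * U x)%R]%E).
  apply: expectation_le => //.
  - by apply: measurableT_comp => //; exact: measurable_funM.
  - by apply: measurable_funD => //; exact: measurable_funM.
  - by move=> x; rewrite addr_ge0// mulr_ge0.
  - apply: aeW => x; apply: (le_trans (expR_le_chord _ (U01 x))).
    by rewrite le_eqVlt; apply/orP; left; apply/eqP; ring.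
rewrite [leLHS](_ : _ = (1 - p + p * expR s)%:E); last first.
  rewrite unlock; under eq_integral do rewrite EFinD EFinM.
  have mEU : measurable_fun setT (EFin \o U) by exact/measurable_EFinP.
  rewrite ge0_integralD//=; last 2 first.
  - by move=> x _; rewrite mule_ge0// lee_fin.
  - exact: measurable_funeM.
  rewrite ge0_integralZl//; last by move=> x _; rewrite lee_fin.
  rewrite integral_cst// [X in (_ * X)%E]probability_setT mul1e.
  by move: EU; rewrite unlock => ->; rewrite -EFinM -EFinD; congr EFin; ring.
by rewrite lee_fin bernoulli_mgf_le.
Qed.

(** Chernoff's bound combined with Hoeffding's lemma for each factor. Independence enters only as
    the factorisation of the moment generating function. *)
Lemma hoeffding_upper d (T : measurableType d) (R : realType)
    (P : probability T R) (J : finType) (U : J -> T -> R) (p a : R) :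
  (forall j, measurable_fun setT (U j)) -> (forall j x, 0 <= U j x <= 1) ->
  (forall j, 'E_P[U j]%E = p%:E) ->
  (forall s : R, ('E_P[(fun x => \prod_j expR (s * U j x))%R] =
     \prod_j 'E_P[(fun x => expR (s * U j x))%R])%E) ->
  0 <= a ->
  (P [set x | (#|J|%:R * (p + a) <= \sum_j U j x)%R] <=
     (expR (- (2 * #|J|%:R * a ^+ 2)))%:E)%E.
Proof.
(* For [a = 0] the bound is 1; Chernoff's bound needs a positive parameter. *)
move=> mU U01 EU prodU; rewrite le_eqVlt => /predU1P[<-|a0].
  rewrite expr0n/= mulr0 oppr0 expR0 probability_le1//.
  rewrite -[X in measurable X]setTI; apply: measurable_fun_le => //.
  exact: measurable_sum.
have mS : measurable_fun setT (fun x => \sum_j U j x) by exact: measurable_sum.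
pose S : {mfun T >-> R} :=
  HB.pack (fun x => \sum_j U j x) (isMeasurableFun.Build _ _ _ _ _ mS).
(* The parameter [s = 4 * a] minimises [s ^+ 2 / 8 - s * a], with minimum [- (2 * a ^+ 2)]. *)
have r0 : 0 < 4 * a by rewrite mulr_gt0.
apply: (le_trans (chernoff S (#|J|%:R * (p + a)) r0)).
have -> : 'M_P S (4 * a) = (\prod_j 'E_P[(fun x => expR (4 * a * U j x))%R])%E.
  rewrite -prodU /mmt_gen_fun; congr expectation; apply/funext => x /=.
  by rewrite mulrC mulr_sumr expR_sum.
have -> : expR (- (2 * #|J|%:R * a ^+ 2)) =
    \prod_(j : J) expR (p * (4 * a) + (4 * a) ^+ 2 / 8) *
    expR (- (4 * a * (#|J|%:R * (p + a)))).
  rewrite -expR_sum -expRD; congr expR.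
  by rewrite sumr_const -mulr_natl; field.
rewrite EFinM lee_wpmul2r ?lee_fin ?expR_ge0// -prodEFin.
(* Nonnegativity is carried through the induction because factors are multiplied monotonically only
   when nonnegative. *)
suff /andP[_] : (0 <= \prod_j 'E_P[(fun x => expR (4 * a * U j x))%R] <=
    \prod_(j : J) (expR (p * (4 * a) + (4 * a) ^+ 2 / 8))%:E)%E by [].
elim/big_ind2 : _ => [|x1 x2 y1 y2 /andP[? ?] /andP[? ?]|j _].
- by rewrite lee01 lexx.
- by rewrite mule_ge0//= lee_pmul.
- by rewrite expectation_ge0//= expectation_expR_le// ltW.
Qed.

Lemma Lfun1_unit_interval d (T : measurableType d) (R : realType)
    (P : probability T R) (U : T -> R) :
  measurable_fun setT U -> (forall x, 0 <= U x <= 1) -> U \in Lfun P 1.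
Proof.
move=> mU U01; apply/Lfun1_integrable; apply: measurable_bounded_integrable => //.
  by rewrite (le_lt_trans (probability_le1 _ _))// ltry.
exists 1; split => // M M1 x _ /=; have /andP[u0 u1] := U01 x.
by rewrite ger0_norm// (le_trans u1)// ltW.
Qed.

(** The [U j] are independent since they read disjoint blocks of the [X i]. The lower tail of [U] is
    the upper tail of [V = 1 - U], so the two one-sided bounds add up to the factor 2. *)
Lemma hoeffding_blocks d (T : measurableType d) (R : realType)
    (P : probability T R) (I J : finType) (X : I -> T -> R) (l : I -> J)
    (U : J -> T -> R) (p a : R) :
  (forall i, measurable_fun setT (X i)) ->
  (forall B : I -> set R, (forall i, measurable (B i)) ->
     P (\bigcap_(i in [set: I]) (X i @^-1` B i)) = (\prod_(i : I) P (X i @^-1` B i))%E) ->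
  (forall j, measurable_fun
     [set: g_sigma_algebraType (cylinder X [pred i | l i == j])] (U j)) ->
  (forall j x, 0 <= U j x <= 1) -> (forall j, 'E_P[U j]%E = p%:E) -> 0 <= a ->
  measurable [set x | (a <= `|#|J|%:R^-1 * (\sum_j U j x) - p|)%R] /\
  (P [set x | (a <= `|#|J|%:R^-1 * (\sum_j U j x) - p|)%R] <=
     (2 * expR (- (2 * #|J|%:R * a ^+ 2)))%:E)%E.
Proof.
move=> mX indX mUj U01 EU a0.
have mU j : measurable_fun setT (U j).
  by apply: measurable_fun_g_sigma (mUj j); exact: cylinder_measurable.
have mB : measurable [set x | (a <= `|#|J|%:R^-1 * (\sum_j U j x) - p|)%R].
  rewrite -[X in measurable X]setTI; apply: measurable_fun_le => //.
  apply: measurableT_comp => //; apply: measurable_funB => //.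
  by apply: measurable_funM => //; exact: measurable_sum.
split => //.
(* For empty [J] the right side is 2, and any probability is below it. *)
have [J0|J0] := posnP #|J|.
  apply: (le_trans (probability_le1 _ mB)).
  by rewrite J0 mulr0 mul0r oppr0 expR0 mulr1 lee_fin ler1n.
pose V j x := 1 - U j x.
have mV j : measurable_fun setT (V j) by exact: measurable_funB.
have V01 j x : 0 <= V j x <= 1.
  by have /andP[u0 u1] := U01 j x; rewrite subr_ge0 u1 gerBl.
have EV j : 'E_P[V j]%E = (1 - p)%:E.
  rewrite (_ : V j = cst 1 \- U j)// expectationB ?expectation_cst ?EU//.
    exact: Lfun_cst.
  exact: Lfun1_unit_interval.
have m_expR (W : J -> T -> R) (s : R) :
    (forall j, measurable_fun
      [set: g_sigma_algebraType (cylinder X [pred i | l i == j])] (W j)) ->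
    (\prod_j 'E_P[(fun x => expR (s * W j x))%R] =
     'E_P[(fun x => \prod_j expR (s * W j x))%R])%E.
  move=> mW; rewrite (expectation_prod_blocks (l := l) mX indX)//.
  - by move=> j; apply: measurableT_comp => //; exact: measurable_funM.
  - by rewrite index_enum_uniq.
have hU := hoeffding_upper mU U01 EU (fun s => esym (m_expR U s mUj)) a0.
have mVj j : measurable_fun
    [set: g_sigma_algebraType (cylinder X [pred i | l i == j])] (V j).
  exact: measurable_funB.
have hV := hoeffding_upper mV V01 EV (fun s => esym (m_expR V s mVj)) a0.
rewrite mulr_natl mulr2n EFinD.
apply: le_trans (leeD hU hV).
have mtail (W : J -> T -> R) (c : R) : (forall j, measurable_fun setT (W j)) ->
    measurable [set x | (c <= \sum_j W j x)%R].
  move=> mW; rewrite -[X in measurable X]setTI; apply: measurable_fun_le => //.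
  exact: measurable_sum.
apply: (le_trans _ (measureU2 _ (mtail _ _ mU) (mtail _ _ mV))).
have N0 : 0 < #|J|%:R :> R by rewrite ltr0n.
apply: le_measure; rewrite ?inE//; first by apply: measurableU; exact: mtail.
move=> x /=; rewrite ler_normr => /orP[h|h]; [left|right].
  by rewrite -ler_pdivlMl// addrC -lerBrDr.
have -> : \sum_j V j x = #|J|%:R - \sum_j U j x.
  by rewrite sumrB sumr_const.
rewrite -ler_pdivlMl// mulrBr mulVf ?gt_eqF//.
by rewrite -addrA lerD2l addrC -lerBrDr opprK (le_trans h)// opprB addrC.
Qed.

(** * Subfamilies and laws of i.i.d. families *)

Lemma iid_family_reindex d (T : measurableType d) (R : realType)
    (I K : finType) (P : probability T R) (D : probability R R)
    (X : I -> T -> R) (f : K -> I) :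
  injective f -> iid_family P D X -> iid_family P D (X \o f).
Proof.
move=> f_inj [mX lawX indX]; split => [k|k B mB|B mB]; [exact: mX|exact: lawX|].
(* By injectivity a fibre of [f] has at most one point: [B'] is [B k] at [f k], and [setT] off the
   image, where it contributes a factor 1. *)
pose B' i := \bigcap_(k in [set k | f k = i]) B k.
have mB' i : measurable (B' i).
  by apply: fin_bigcap_measurable => //; exact: finite_finset.
have B'f k : B' (f k) = B k.
  apply/seteqP; split => [x /(_ k erefl)//|x Bx k' /f_inj ->//].
have -> : \bigcap_(k in [set: K]) ((X \o f) k @^-1` B k) =
    \bigcap_(i in [set: I]) (X i @^-1` B' i).
  apply/seteqP; split => [x h i _ k /= <-|x h k _]; first exact: h.
  by have := h (f k) Logic.I; rewrite /= B'f.
rewrite indX// (bigID (mem (f @: [set: K])%SET))/= [X in (_ * X)%E]big1 ?mule1.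
  rewrite big_imset/=; last by move=> ? ? _ _; exact: f_inj.
  by apply: eq_big => [k|k _]; rewrite ?inE//= B'f.
move=> i fi; rewrite (_ : B' i = setT) ?preimage_setT ?probability_setT//.
rewrite -subTset => x _ k /= fk.
by move: fi; rewrite -fk imset_f ?inE.
Qed.

(** [D] determines the joint law: the laws of the two vectors agree on rectangles, a pi-system
    generating the sigma-algebra put on [I -> R]. This lets expectations move between the batch
    space and the space of fresh samples. *)
Lemma iid_family_expectation d (T : measurableType d) d' (T' : measurableType d')
    (R : realType) (I : finType) (P : probability T R) (Q : probability T' R)
    (D : probability R R) (X : I -> T -> R) (Z : I -> T' -> R) (F : (I -> R) -> R) :
  iid_family P D X -> iid_family Q D Z ->
  measurable_fun [set: g_sigma_algebraType
    (cylinder (fun i (x : I -> R) => x i) predT)] F ->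
  (forall x, 0 <= F x) ->
  'E_P[fun w => F (X^~ w)]%E = 'E_Q[fun w => F (Z^~ w)]%E.
Proof.
move=> [mX lawX indX] [mZ lawZ indZ] mF F0.
pose G := cylinder (fun i (x : I -> R) => x i) predT.
have mvec d0 (T0 : measurableType d0) (Y : I -> T0 -> R) :
    (forall i, measurable_fun setT (Y i)) ->
    measurable_fun setT (fun w => (Y^~ w : g_sigma_algebraType G)).
  move=> mY; refine (@measurability _ _ T0 (g_sigma_algebraType G) setT _ G _ _) => //.
  move=> _ [_ [B [mB _ ->]] <-]; rewrite setTI preimage_bigcap.
  apply: fin_bigcap_measurable; first exact: finite_finset.
  by move=> i _; rewrite -[X in measurable X]setTI; exact: mY.
pose vX : {mfun T >-> g_sigma_algebraType G} :=
  HB.pack (fun w => (X^~ w : g_sigma_algebraType G))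
    (isMeasurableFun.Build _ _ _ _ _ (mvec _ _ _ mX)).
pose vZ : {mfun T' >-> g_sigma_algebraType G} :=
  HB.pack (fun w => (Z^~ w : g_sigma_algebraType G))
    (isMeasurableFun.Build _ _ _ _ _ (mvec _ _ _ mZ)).
have mEF : measurable_fun [set: g_sigma_algebraType G] (EFin \o F).
  by exact/measurable_EFinP.
rewrite unlock.
transitivity (\int[distribution P vX]_x (F x)%:E)%E.
  by rewrite ge0_integral_distribution// => x; rewrite lee_fin.
transitivity (\int[distribution Q vZ]_x (F x)%:E)%E; last first.
  by rewrite ge0_integral_distribution// => x; rewrite lee_fin.
apply: eq_measure_integral => A mA _.
apply: (@measure_unique _ R (g_sigma_algebraType G) G (fun=> setT) _ _ _ _
  (distribution P vX) (distribution Q vZ)) => //.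
- exact: cylinderI.
- by move=> _; exact: cylinderT.
- by rewrite bigcup_const.
- move=> _ [B [mB _ ->]].
  transitivity (P (\bigcap_(i in setT) X i @^-1` B i)); first by [].
  transitivity (Q (\bigcap_(i in setT) Z i @^-1` B i)); last by [].
  by rewrite indX// indZ//; apply: eq_bigr => i _; rewrite lawX// lawZ.
- move=> _; apply: le_lt_trans (ltry 1).
  exact: (@probability_le1 _ _ _ (distribution P vX)).
Qed.

(** * Distortion *)

(** In a nonincreasing list the entries above [c] form a prefix. *)
Lemma lt_nth_sorted_ge (R : realDomainType) (s : seq R) (c : R) (r : nat) :
  sorted (fun a b : R => b <= a) s -> (r < size s)%N ->
  (c < nth 0 s r) = (r < count (fun a : R => (c < a)%R) s)%N.
Proof.
elim: s r => [//|a s IH] r /= sas rs.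
have ss := path_sorted sas.
have [ca|ac] := ltP c a.
  case: r rs => [|r]; first by rewrite ca.
  by rewrite ltnS => rs; rewrite add1n ltnS; exact: IH.
have le_a : all (fun b => b <= a) (a :: s).
  by rewrite /= lexx; apply: order_path_min sas => x y z yx zy; exact: le_trans zy yx.
have -> : count (fun b => c < b) s = 0%N.
  apply/eqP; rewrite -leqn0 leqNgt -has_count; apply/hasPn => b bs.
  by rewrite -leNgt (le_trans _ ac)//; apply: (allP le_a); rewrite inE bs orbT.
rewrite addn0 ltn0; apply/negbTE; rewrite -leNgt (le_trans _ ac)//.
by apply: (allP le_a); exact: (mem_nth 0 (s := a :: s)).
Qed.

Lemma lt_kth_largest (R : realType) m (x : 'I_m -> R) (r : 'I_m) (c : R) :
  (c < kth_largest x r) = (r < #|[set k | (c < x k)%R]%SET|)%N.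
Proof.
rewrite /kth_largest lt_nth_sorted_ge; last 2 first.
- by apply: sort_sorted => a b; exact: le_total.
- by rewrite size_sort size_map size_enum_ord.
by rewrite count_sort count_map cardsE cardE size_filter enumT.
Qed.

Lemma measurable_kth_largest d (T : measurableType d) (R : realType) m
    (x : 'I_m -> T -> R) (r : 'I_m) :
  (forall k, measurable_fun setT (x k)) ->
  measurable_fun setT (fun w => kth_largest (x^~ w) r).
Proof.
move=> mx; apply: (measurability _ (RGenOInfty.measurableE R)) => //.
move=> _ [_ [c ->] <-]; rewrite setTI.
(* The value at position [r] (counted from 0) exceeds [c] iff all samples of some index set with
   more than [r] elements do; there are finitely many such sets. *)
rewrite (_ : _ @^-1` _ = \bigcup_(S in [set S : {set 'I_m} | (r < #|S|)%N])
    \bigcap_(k in [set` S]) (x k @^-1` `]c, +oo[)); last first.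
  apply/seteqP; split => w /=.
    rewrite in_itv/= andbT lt_kth_largest => h.
    exists [set k | (c < x k w)%R]%SET => //= k /=.
    by rewrite inE in_itv/= andbT.
  move=> [S /= rS h]; rewrite in_itv/= andbT lt_kth_largest.
  apply: (leq_trans rS); apply/subset_leq_card/fintype.subsetP => k kS.
  by rewrite inE; have := h k kS; rewrite /= in_itv/= andbT.
apply: fin_bigcup_measurable; first exact: finite_finset.
move=> S _; apply: fin_bigcap_measurable; first exact: finite_finset.
by move=> k _; rewrite -[_ @^-1` _]setTI; apply: mx => //; exact: measurable_itv.
Qed.

Lemma measurable_sw d (T : measurableType d) (R : realType) n m
    (sigma : profile n m) (x : 'I_n -> 'I_m -> T -> R) (j : 'I_m) :
  (forall i k, measurable_fun setT (x i k)) ->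
  measurable_fun setT (fun w => sw sigma (fun i k => x i k w) j).
Proof.
move=> mx; apply: measurable_sum => i.
exact: (measurable_kth_largest (x := x i) (pos sigma i j)).
Qed.

Lemma measurable_distortion d (T : measurableType d) (R : realType) n m
    (sigma : profile n m) (x : 'I_n -> 'I_m -> T -> R) (j : 'I_m) :
  (forall i k, measurable_fun setT (x i k)) ->
  measurable_fun setT (fun w => distortion sigma (fun i k => x i k w) j).
Proof.
move=> mx; have msw k := measurable_sw sigma k mx.
have mmax (s : seq 'I_m) : measurable_fun setT
    (fun w => \big[Num.max/0]_(k <- s) sw sigma (fun i k => x i k w) k).
  elim: s => [|k s IH]; first by under eq_fun do rewrite big_nil; exact: measurable_cst.
  by under eq_fun do rewrite big_cons; exact: measurable_maxr.
apply: measurable_funM => //.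
(* [0 `^ (-1) = 0 = 0^-1] : the junk values agree. *)
under eq_fun do rewrite -powR_inv1 ?bigmax_ge_id//.
exact: (measurableT_comp (measurable_powR _)).
Qed.

Section distortion_bounds.
Variables (R : realType) (n m : nat) (sigma : profile n m) (Y : 'I_n -> 'I_m -> R).

Lemma kth_largest_mem (x : 'I_m -> R) (r : 'I_m) :
  kth_largest x r \in [seq x k | k <- enum 'I_m].
Proof.
by rewrite -(mem_sort (fun a b => b <= a)) mem_nth// size_sort size_map size_enum_ord.
Qed.

Lemma sum_kth_largest (x : 'I_m -> R) : \sum_r kth_largest x r = \sum_k x k.
Proof.
rewrite /kth_largest; set s := sort _ _.
have szs : size s = m by rewrite size_sort size_map size_enum_ord.
transitivity (\sum_(a <- s) a).
  by rewrite (big_nth 0) szs big_mkord.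
rewrite (perm_big [seq x k | k <- enum 'I_m]) ?perm_sort//=.
by rewrite big_map big_enum.
Qed.

(** A ranking is a bijection between alternatives and positions, and sorting permutes the samples,
    so each sample counts once. *)
Lemma sum_sw : \sum_j sw sigma Y j = \sum_i \sum_k Y i k.
Proof.
rewrite exchange_big/=; apply: eq_bigr => i _.
rewrite -[RHS]sum_kth_largest [RHS](reindex_inj (@perm_inj _ ((sigma i)^-1)%g)).
by apply: eq_bigr.
Qed.

Hypothesis Y01 : forall i k, 0 < Y i k <= 1.

Lemma util_bounds i j : 0 < util sigma Y i j <= 1.
Proof. by rewrite /util; have /mapP[k _ ->] := kth_largest_mem (Y i) (pos sigma i j). Qed.

Lemma sw_ge0 j : 0 <= sw sigma Y j.
Proof. by apply: sumr_ge0 => i _; case/andP: (util_bounds i j) => /ltW. Qed.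

Lemma sw_le j : sw sigma Y j <= n%:R.
Proof.
rewrite -[leRHS]mulr_natl mulr1 -[n in leRHS]card_ord -sumr_const.
by apply: ler_sum => i _; case/andP: (util_bounds i j).
Qed.

Lemma distortion_bounds j : 0 <= distortion sigma Y j <= 1.
Proof.
rewrite /distortion; set M := \big[_/_]_(_ < _) _.
have M0 : 0 <= M by exact: bigmax_ge_id.
have jM : sw sigma Y j <= M by exact: le_bigmax.
(* If the maximal welfare is 0, the convention [0^-1 = 0] makes the distortion 0. *)
rewrite divr_ge0 ?sw_ge0//=; have [->|MN0] := eqVneq M 0.
  by rewrite invr0 mulr0.
by rewrite ler_pdivrMr ?mul1r// lt0r MN0.
Qed.

Lemma sum_distortion_ge : (0 < n)%N ->
  (\sum_i \sum_k Y i k) / n%:R <= \sum_j distortion sigma Y j.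
Proof.
move=> n0; rewrite -sum_sw mulr_suml; apply: ler_sum => j _.
rewrite /distortion; set M := \big[_/_]_(_ < _) _.
apply: ler_wpM2l; first exact: sw_ge0.
(* Some voter exists and gives [j] positive utility; with [0 < M <= n] the inverses can be
   compared. *)
have M0 : 0 < M.
  apply: (@lt_le_trans _ _ (sw sigma Y j)); last exact: le_bigmax.
  rewrite /sw (bigD1 (Ordinal n0))//= ltr_pwDl//.
    by case/andP: (util_bounds (Ordinal n0) j).
  by apply: sumr_ge0 => i _; case/andP: (util_bounds i j) => /ltW.
rewrite lef_pV2 ?posrE ?ltr0n//; apply/bigmax_leP; split => // k _.
exact: sw_le.
Qed.

End distortion_bounds.

(** * Truncation to the unit interval and expected distortion *)

Definition clamp01 (R : realType) (x : R) : R := Num.max 0 (Num.min 1 x).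

Lemma clamp01_bounds (R : realType) (x : R) : 0 <= clamp01 x <= 1.
Proof. by rewrite le_max lexx/= ge_max ler01 ge_min lexx. Qed.

Lemma clamp01_id (R : realType) (x : R) : 0 <= x <= 1 -> clamp01 x = x.
Proof. by move=> /andP[x0 x1]; rewrite /clamp01 min_r// max_r. Qed.

Lemma measurable_clamp01 d (T : measurableType d) (R : realType) (f : T -> R) :
  measurable_fun setT f -> measurable_fun setT (fun x => clamp01 (f x)).
Proof.
by move=> mf; apply: measurable_maxr => //; exact: measurable_minr.
Qed.

Lemma probability1_ae d (T : measurableType d) (R : realType)
    (P : probability T R) (A : set T) :
  measurable A -> P A = 1%E -> {ae P, forall x, A x}.
Proof.
move=> mA PA; exists (~` A); split => //; first exact: measurableC.
by rewrite probability_setC// PA subee.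
Qed.

Lemma measurable_unit_interval (R : realType) : measurable [set x : R | 0 < x <= 1].
Proof.
by rewrite (_ : [set _ | _] = `]0, 1]%classic) //; exact: measurable_itv.
Qed.

Section iid.
Variables (d : measure_display) (T : measurableType d) (R : realType) (I : finType).
Variables (P : probability T R) (D : probability R R) (X : I -> T -> R).
Hypothesis iidX : iid_family P D X.

(** All factors of the product rule are 1. With [S] the interval (0, 1], all samples lie in it
    simultaneously, almost surely. *)
Lemma iid_family_support (S : set R) : measurable S -> D S = 1%E ->
  measurable (\bigcap_(i in [set: I]) (X i @^-1` S)) /\
  P (\bigcap_(i in [set: I]) (X i @^-1` S)) = 1%E.
Proof.
case: iidX => mX lawX indX mS DS; split.
  apply: fin_bigcap_measurable => [|i _]; first exact: finite_finset.
  by rewrite -[X in measurable X]setTI; exact: mX.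
by rewrite (indX (fun=> S))// big1// => i _; rewrite lawX.
Qed.

Hypothesis D01 : D [set x : R | 0 < x <= 1] = 1%E.
Variable mu : R.
Hypothesis Dmu : (\int[D]_x x%:E = mu%:E)%E.

Lemma integral_clamp01 : (\int[D]_x (clamp01 x)%:E = mu%:E)%E.
Proof.
rewrite -Dmu; apply: ae_eq_integral => //.
- by apply/measurable_EFinP; exact: measurable_clamp01.
have := probability1_ae (@measurable_unit_interval R) D01.
apply: filterS => x /= /andP[x0 x1] _.
by rewrite clamp01_id// ltW.
Qed.

Lemma expectation_clamp01 i : 'E_P[fun w => clamp01 (X i w)]%E = mu%:E.
Proof.
case: iidX => mX lawX _.
pose Xi : {mfun T >-> R} := HB.pack (X i) (isMeasurableFun.Build _ _ _ _ _ (mX i)).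
rewrite -integral_clamp01 unlock.
transitivity (\int[distribution P Xi]_x (clamp01 x)%:E)%E.
  rewrite ge0_integral_distribution//.
    by apply/measurable_EFinP; exact: measurable_clamp01.
  by move=> x; rewrite lee_fin; case/andP: (clamp01_bounds x).
by apply: eq_measure_integral => A mA _; exact: lawX.
Qed.

(** If the mean were 0, the nonnegative function [clamp01] would vanish [D]-almost everywhere, yet
    it is positive on (0, 1], which has mass 1. *)
Lemma mean_gt0 : 0 < mu.
Proof.
have mc : measurable_fun setT (fun x : R => (clamp01 x)%:E).
  by apply/measurable_EFinP; exact: measurable_clamp01.
have c0 (x : R) : 0 <= clamp01 x by case/andP: (clamp01_bounds x).
have mu0 : 0 <= mu.
  by rewrite -lee_fin -integral_clamp01 integral_ge0// => x _; rewrite lee_fin.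
rewrite lt_neqAle mu0 andbT; apply/eqP => mu_eq0.
have : (\int[D]_x `|(clamp01 x)%:E| = mu%:E)%E.
  rewrite -integral_clamp01.
  by apply: eq_integral => x _; rewrite gee0_abs ?lee_fin.
rewrite -mu_eq0 => /(ae_eq_integral_abs D measurableT mc) [N [mN DN0 sN]].
have : (D [set x : R | (0 < x <= 1)%R] <= D N)%E.
  apply: le_measure; rewrite ?inE//; first exact: measurable_unit_interval.
  move=> x /= /andP[x0 x1]; apply: sN => /= /(_ Logic.I) [].
  by rewrite clamp01_id ?(ltW x0)// => x_eq0; rewrite x_eq0 ltxx in x0.
by rewrite D01 DN0 lee_fin ler10.
Qed.

End iid.

(* The samples lie in (0, 1] only almost surely; clamping makes the distortion
   bounded everywhere, and changes it on a null set only. *)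
Definition clamped_distortion (R : realType) n m (sigma : profile n m)
    (Y : 'I_n -> 'I_m -> R) (j : 'I_m) : R := clamp01 (distortion sigma Y j).

Lemma exp_dist_clamped_distortion dQ (T : measurableType dQ) (R : realType)
    (Q : probability T R) (D : probability R R) n m
    (Z : 'I_n -> 'I_m -> T -> R) (sigma : profile n m) (j : 'I_m) :
  iid_family Q D (fun k : 'I_n * 'I_m => Z k.1 k.2) ->
  D [set x : R | 0 < x <= 1] = 1%E ->
  exp_dist Q Z sigma j = 'E_Q[fun w => clamped_distortion sigma (fun i r => Z i r w) j]%E.
Proof.
move=> iidZ D01; have [mZ _ _] := iidZ.
have md := measurable_distortion sigma j (fun i k => mZ (i, k)).
have [mS QS] := iid_family_support iidZ (@measurable_unit_interval R) D01.
rewrite /exp_dist unlock; apply: ae_eq_integral => //.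
- exact/measurable_EFinP.
- by apply/measurable_EFinP; exact: measurable_clamp01.
have := probability1_ae mS QS; apply: filterS => w /= Sw _.
rewrite /clamped_distortion clamp01_id//; apply: distortion_bounds => i k.
exact: (Sw (i, k) Logic.I).
Qed.

Lemma sum_expectation_clamped_distortion_ge dQ (T : measurableType dQ) (R : realType)
    (Q : probability T R) (D : probability R R) (mu : R) n m
    (Z : 'I_n -> 'I_m -> T -> R) (sigma : profile n m) :
  iid_family Q D (fun k : 'I_n * 'I_m => Z k.1 k.2) ->
  D [set x : R | 0 < x <= 1] = 1%E -> (\int[D]_x x%:E = mu%:E)%E -> (0 < n)%N ->
  ((m%:R * mu)%:E <= \sum_j 'E_Q[fun w => clamped_distortion sigma (fun i r => Z i r w) j])%E.
Proof.
move=> iidZ D01 Dmu n0; have [mZ _ _] := iidZ.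
have md j := measurable_distortion sigma j (fun i k => mZ (i, k)).
have [mS QS] := iid_family_support iidZ (@measurable_unit_interval R) D01.
have c0 (x : R) : 0 <= clamp01 x by case/andP: (clamp01_bounds x).
have mcZ (k : 'I_n * 'I_m) : measurable_fun setT (fun w => clamp01 (Z k.1 k.2 w)).
  exact: measurable_clamp01.
have n_neq0 : n%:R != 0 :> R by rewrite pnatr_eq0 -lt0n.
(* Each of the [n * m] truncated samples has mean [mu]; dividing their total by [n] gives mean
   [m * mu]. *)
have -> : (m%:R * mu)%:E =
    'E_Q[fun w => (n%:R^-1 * \sum_(k : 'I_n * 'I_m) clamp01 (Z k.1 k.2 w))%R]%E.
  rewrite unlock; under eq_integral do rewrite EFinM.
  rewrite ge0_integralZl//; last first.
  - by move=> w _; rewrite lee_fin sumr_ge0.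
  - by apply/measurable_EFinP; exact: measurable_sum.
  under eq_integral do rewrite -sumEFin.
  rewrite ge0_integral_sum//; last 2 first.
  - by move=> k; exact/measurable_EFinP.
  - by move=> k w _; rewrite lee_fin.
  rewrite (eq_bigr (fun=> mu%:E)); last first.
    by move=> k _; have := expectation_clamp01 iidZ D01 Dmu k; rewrite unlock.
  rewrite sumEFin -EFinM sumr_const card_prod !card_ord; congr EFin.
  by rewrite -(mulr_natr mu) natrM; field.
rewrite [X in (_ <= X)%E](_ : _ =
    'E_Q[fun w => (\sum_j clamped_distortion sigma (fun i r => Z i r w) j)%R]%E); last first.
  rewrite expectation.unlock; under [RHS]eq_integral do rewrite -sumEFin.
  rewrite ge0_integral_sum// => [j|j w _]; last by rewrite lee_fin; exact: c0.
  by apply/measurable_EFinP; exact: measurable_clamp01.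
apply: expectation_le.
- by apply: measurable_funM => //; exact: measurable_sum.
- by apply: measurable_sum => j; exact: measurable_clamp01.
- by move=> w; rewrite mulr_ge0 ?invr_ge0 ?sumr_ge0.
- by move=> w; rewrite sumr_ge0// => j _; exact: c0.
(* When all samples lie in (0, 1], every truncation is the identity and [sum_distortion_ge] applies
   pointwise. *)
have := probability1_ae mS QS; apply: filterS => w /= Sw.
have Z01 i k : 0 < Z i k w <= 1 by exact: (Sw (i, k) Logic.I).
rewrite mulrC -(pair_bigA _ (fun i k => clamp01 (Z i k w)))/=.
rewrite [X in X / _ <= _](_ : _ = \sum_i \sum_k Z i k w); last first.
  apply: eq_bigr => i _; apply: eq_bigr => k _.
  by have /andP[/ltW z0 z1] := Z01 i k; rewrite clamp01_id ?z0.
apply: (le_trans (sum_distortion_ge sigma Z01 n0)); apply: ler_sum => j _.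
by rewrite /clamped_distortion clamp01_id//; exact: distortion_bounds.
Qed.

(** * Number of batches, union bound and choice of the alternative *)

Lemma num_batches_tail_le (R : realType) (m : nat) (mu eps delta : R) :
  (0 < m)%N -> 0 < mu -> 0 < eps -> 0 < delta ->
  2 * expR (- (2 * (num_batches m mu eps delta)%:R * (eps * mu / 2) ^+ 2)) <= delta / m%:R.
Proof.
move=> m0 mu0 e0 d0; rewrite /num_batches; set x := (X in Num.ceil X).
have mR : 0 < m%:R :> R by rewrite ltr0n.
(* The absolute value in [num_batches] only increases the ceiling, so the bound holds for negative
   [x] too. *)
have hx : x <= `|Num.ceil x|%N%:R.
  by rewrite (le_trans (ceil_ge x))// natr_absz ler_int ler_norm.
have c0 : 0 < 2 * m%:R / delta by rewrite divr_gt0// mulr_gt0.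
rewrite -ler_pdivlMl//.
have -> : 2^-1 * (delta / m%:R) = expR (- ln (2 * m%:R / delta)).
  by rewrite expRN lnK ?posrE// invf_div invfM mulrCA.
rewrite ler_expR lerN2.
have -> : ln (2 * m%:R / delta) = 2 * x * (eps * mu / 2) ^+ 2.
  by rewrite /x; field; rewrite !gt_eqF.
by rewrite ler_wpM2r ?sqr_ge0// ler_wpM2l.
Qed.

Lemma measure_bigsetU_le d (T : measurableType d) (R : realType)
    (P : probability T R) (I : Type) (s : seq I) (A : I -> set T) :
  (forall i, measurable (A i)) ->
  (P (\big[setU/set0]_(i <- s) A i) <= \sum_(i <- s) P (A i))%E.
Proof.
move=> mA; elim: s => [|i s IH]; first by rewrite !big_nil measure0.
rewrite !big_cons; apply: le_trans (leeD2l _ IH).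
by apply: measureU2 => //; exact: bigsetU_measurable.
Qed.

(** Batch [t] is the subfamily along [k |-> (t, k.1, k.2)], hence has the same joint law as the
    fresh samples. *)
Lemma expectation_clamped_distortion_batch d (T : measurableType d)
    dQ (TQ : measurableType dQ)
    (R : realType) (P : probability T R) (Q : probability TQ R)
    (D : probability R R) (N n m : nat) (X : 'I_N -> 'I_n -> 'I_m -> T -> R)
    (Z : 'I_n -> 'I_m -> TQ -> R) (sigma : profile n m) (j : 'I_m) (t : 'I_N) :
  iid_family P D (fun k : 'I_N * 'I_n * 'I_m => X k.1.1 k.1.2 k.2) ->
  iid_family Q D (fun k : 'I_n * 'I_m => Z k.1 k.2) ->
  'E_P[fun w => clamped_distortion sigma (fun i r => X t i r w) j]%E =
  'E_Q[fun w => clamped_distortion sigma (fun i r => Z i r w) j]%E.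
Proof.
move=> iidX iidZ.
have inj_t : injective (fun k : 'I_n * 'I_m => (t, k.1, k.2)).
  by move=> [i r] [i' r'] [-> ->].
apply: (iid_family_expectation
  (F := fun y => clamped_distortion sigma (fun i r => y (i, r)) j)
  (iid_family_reindex inj_t iidX) iidZ).
  apply: measurable_clamp01.
  by apply: measurable_distortion => i r; exact: measurable_coord.
by move=> y; case/andP: (clamp01_bounds (distortion sigma (fun i r => y (i, r)) j)).
Qed.

Theorem theorem10 (R : realType) (D : probability R R) (mu : R)
  (hsupp : D [set x : R | 0 < x <= 1] = 1%E)
  (hmean : (\int[D]_x (x%:E) = mu%:E)%E)
  (n m : nat) (hn : (0 < n)%N) (hm : (0 < m)%N) (sigma : profile n m)
  (eps delta : R) (heps : 0 < eps) (hdelta : 0 < delta)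
  (* fresh samples used to define E[dist(j, sigma)] *)
  (dQ : measure_display) (OmegaQ : measurableType dQ) (Q : probability OmegaQ R)
  (Z : 'I_n -> 'I_m -> OmegaQ -> R)
  (hZ : iid_family Q D (fun k : 'I_n * 'I_m => Z k.1 k.2))
  (* the T batches of n*m i.i.d. samples *)
  (d : measure_display) (Omega : measurableType d) (P : probability Omega R)
  (X : 'I_(num_batches m mu eps delta) -> 'I_n -> 'I_m -> Omega -> R)
  (hX : iid_family P D
          (fun k : 'I_(num_batches m mu eps delta) * 'I_n * 'I_m =>
             X k.1.1 k.1.2 k.2)) :
  exists E : set Omega, [/\ measurable E, ((1 - delta)%:E <= P E)%E &
    forall w, E w -> forall jsamp : 'I_m,
      (forall j : 'I_m, mu_hat sigma X w j <= mu_hat sigma X w jsamp) ->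
      ((1 - eps)%:E * \big[Order.max/-oo%E]_(j < m) exp_dist Q Z sigma j
         <= exp_dist Q Z sigma jsamp)%E].
Proof.
have mu0 : 0 < mu by exact: (mean_gt0 hsupp hmean).
have [mX _ indX] := hX.
pose e (j : 'I_m) : R := fine (exp_dist Q Z sigma j).
have [mZ _ _] := hZ.
have mcZ j : measurable_fun setT (fun w => clamped_distortion sigma (fun i r => Z i r w) j).
  apply: measurable_clamp01.
  exact: (measurable_distortion sigma j (fun i k => mZ (i, k))).
have c01 (T : Type) (Y : 'I_n -> 'I_m -> T -> R) j w :
  0 <= clamped_distortion sigma (fun i r => Y i r w) j <= 1 by exact: clamp01_bounds.
have eE j : exp_dist Q Z sigma j = (e j)%:E.
  rewrite /e fineK// (exp_dist_clamped_distortion _ _ hZ hsupp).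
  by apply: expectation_fin_num; exact: Lfun1_unit_interval.
(* Half of the admissible loss [eps * mu]: the estimates of the chosen and of the best alternative
   may each err by [a]. *)
pose a := eps * mu / 2.
have a0 : 0 < a by rewrite divr_gt0// mulr_gt0.
pose N := num_batches m mu eps delta.
pose U (j : 'I_m) (t : 'I_N) w := clamped_distortion sigma (fun i r => X t i r w) j.
pose Bad (j : 'I_m) := [set w | a <= `|#|'I_N|%:R^-1 * (\sum_t U j t w) - e j|].
have hBad j : measurable (Bad j) /\ (P (Bad j) <= (delta / m%:R)%:E)%E.
  (* The blocks are the batches: [k.1.1] is the batch index of a sample. *)
  have [] := @hoeffding_blocks _ Omega R P _ _ _ (fun k => k.1.1) (U j) (e j) a mX indX.
  - move=> t; apply: measurable_clamp01; apply: measurable_distortion => i r.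
    apply: (@measurable_coord Omega R _ (fun k : 'I_N * 'I_n * 'I_m =>
      X k.1.1 k.1.2 k.2) [pred k | k.1.1 == t] (t, i, r)).
    by rewrite inE.
  - by move=> t w; exact: clamp01_bounds.
  - move=> t; rewrite -eE (exp_dist_clamped_distortion _ _ hZ hsupp).
    exact: expectation_clamped_distortion_batch hX hZ.
  - exact: ltW.
  move=> mB PB; split => //; apply: (le_trans PB).
  by rewrite lee_fin card_ord num_batches_tail_le.
have [mS PS] := iid_family_support hX (@measurable_unit_interval R) hsupp.
set S := \bigcap_(i in _) _ in mS PS.
pose B := \big[setU/set0]_(j < m) Bad j.
have mB : measurable B by apply: bigsetU_measurable => j _; exact: (hBad j).1.
have PB : (P B <= delta%:E)%E.
  apply: (le_trans (measure_bigsetU_le _ _ (fun j => (hBad j).1))).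
  apply: (@le_trans _ _ (\sum_(j < m) (delta / m%:R)%:E)%E).
    by apply: lee_sum => j _; exact: (hBad j).2.
  rewrite sumEFin sumr_const card_ord lee_fin -(mulr_natr (_ / _)) divfK//.
  by rewrite pnatr_eq0 -lt0n.
(* [B] is the event that some estimate is off by at least [a]. Intersecting with [S], which has
   probability 1, costs nothing and makes [mu_hat] equal to the truncated average there. *)
exists (S `&` ~` B); split.
- by apply: measurableI => //; exact: measurableC.
- rewrite -[S `&` _]setCK setCI setCK probability_setC; last first.
    by apply: measurableU => //; exact: measurableC.
  rewrite EFinB leeB// (le_trans _ PB)//.
  apply: (le_trans (measureU2 _ (measurableC mS) mB)).
  have PSC : P (~` S) = 0%E by rewrite probability_setC// PS subee.
  by rewrite [X in (X + _)%E]PSC add0e.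
move=> w [Sw Bw] js hjs.
have near_e j : `|mu_hat sigma X w j - e j| < a.
  rewrite ltNge; apply/negP => h; apply: Bw.
  rewrite /B (bigD1 j)//=; left; rewrite /Bad/= card_ord.
  rewrite (eq_bigr (fun t => distortion sigma (fun i r => X t i r w) j))// => t _.
  rewrite /U /clamped_distortion clamp01_id//; apply: distortion_bounds => i r.
  exact: (Sw (t, i, r) Logic.I).
(* [js] serves as the starting point that the maximum over ['I_m] requires. *)
have [j0 je0] : exists j0, forall j, e j <= e j0.
  by exists [arg max_(j > js) e j]%O; case: arg_maxP => //= j0 _ h j; exact: h.
(* The maximum of the [e j] is at least their average, and their sum is at least [m * mu]. *)
have mu_e : mu <= e j0.
  have := sum_expectation_clamped_distortion_ge sigma hZ hsupp hmean hn.
  rewrite (eq_bigr (fun j => (e j)%:E)); last first.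
    by move=> j _; rewrite -(exp_dist_clamped_distortion _ _ hZ hsupp) eE.
  rewrite sumEFin lee_fin => h.
  rewrite -(ler_pM2l (_ : 0 < m%:R)) ?ltr0n//; apply: (le_trans h).
  rewrite mulr_natl -[m in leRHS]card_ord -sumr_const.
  by apply: ler_sum => j _.
have -> : \big[Order.max/-oo%E]_(j < m) exp_dist Q Z sigma j = (e j0)%:E.
  apply/eqP; rewrite eq_le -{2}eE le_bigmax andbT.
  by apply/bigmax_leP; split => [|j _]; rewrite ?leNye// eE lee_fin.
rewrite eE -EFinM lee_fin.
(* The chain is [e js > mu_hat js - a >= mu_hat j0 - a > e j0 - 2 * a], where
   [2 * a = eps * mu <= eps * e j0]. *)
have h1 := near_e js; have h2 := near_e j0; have h3 := hjs j0.
have h4 : eps * mu <= eps * e j0 by rewrite ler_pM2l.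
move: h1 h2; rewrite !ltr_norml /a => /andP[h11 h12] /andP[h21 h22].
lra.
Qed.
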